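(* For integers $n\ge2$ and $0\le t\le n-1$, the number of $(102,210)$-avoiding inversion sequences $e$ of length $n$ with $\mathrm{rank}(e)=t$ is $$c(n-t-1,t+1)+(t+1)\sum_{i=0}^{n-t-3}\binom{2i+t+3}{i}+\sum_{i=0}^{n-t-4}\big(c(i,t+6)-c(i,5)\big),$$ where $c(j,k):=\frac{k}{2j+k}\binom{2j+k}{j}=[x^j]C(x)^k$ and $C(x)=\sum_{n\ge0}\frac{1}{n+1}\binom{2n}{n}x^n$ is the generating function of the Catalan numbers. (Sums whose upper limit is less than their lower limit are $0$.)
   Context: An inversion sequence of length $n$ is an integer sequence $e=(e_1,\dots,e_n)$ with $0\le e_j\le j-1$ for all $j$. It contains a pattern $w=w_1w_2w_3$ if there are indices $i_1<i_2<i_3$ such that $e_{i_1}e_{i_2}e_{i_3}$ is order-isomorphic to $w$ (same relations $<,=,>$ between corresponding pairs of entries); otherwise it avoids $w$. ''$(w,w')$-avoiding'' means avoiding both $w$ and $w'$. $\max(e)$ is the largest entry, and $\mathrm{fdes}(e)$ is the position $p$ of the first descent: $e_1\le\cdots\le e_p>e_{p+1}$, with the convention $e_{n+1}=-1$. For a $102$-avoiding $e$, $\mathrm{rank}(e):=\mathrm{fdes}(e)-\max(e)-1$. *)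

(* Defs.v *)
From HB Require Import structures.
From mathcomp Require Import all_boot all_order all_algebra.

Set Implicit Arguments.
Unset Strict Implicit.
Unset Printing Implicit Defensive.

Import Order.TTheory GRing.Theory Num.Theory.

(* Entries and positions are indexed from 0: the entry e_j of the literature is
   [e (j - 1)], so the condition 0 <= e_j <= j - 1 reads [e i <= i].  Such an
   entry is less than n, hence the codomain 'I_n loses no inversion sequence. *)
Definition inversion_seq (n : nat) : {set {ffun 'I_n -> 'I_n}} :=
  [set e : {ffun 'I_n -> 'I_n} | [forall i : 'I_n, (e i <= i)%N]].

Definition order_iso (k : nat) (s w : k.-tuple nat) : bool :=
  [forall a : 'I_k, forall b : 'I_k,
    ((tnth s a < tnth s b)%N == (tnth w a < tnth w b)%N) &&
    ((tnth s a == tnth s b) == (tnth w a == tnth w b))].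

Definition contains (n : nat) (e : {ffun 'I_n -> 'I_n})
    (w : 3.-tuple nat) : bool :=
  [exists i1 : 'I_n, exists i2 : 'I_n, exists i3 : 'I_n,
    [&& (i1 < i2)%N, (i2 < i3)%N &
        order_iso [tuple (e i1 : nat); (e i2 : nat); (e i3 : nat)] w]].

Definition avoids (n : nat) (e : {ffun 'I_n -> 'I_n})
    (w : 3.-tuple nat) : bool := ~~ contains e w.

Definition pat102 : 3.-tuple nat := [tuple 1%N; 0%N; 2%N].
Definition pat210 : 3.-tuple nat := [tuple 2%N; 1%N; 0%N].

Definition max_entry (n : nat) (e : {ffun 'I_n -> 'I_n}) : nat :=
  (\max_(i < n) (e i : nat))%N.

(* The entry at (0-based) position p, equal to -1 past the end of e. *)
Definition entry (n : nat) (e : {ffun 'I_n -> 'I_n}) (p : nat) : int :=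
  if insub p is Some i then (e i : nat)%:Z else (-1)%R.

(* [find] returns the 0-based position of the first descent, [.+1] makes it
   1-based.  For n > 0 a descent exists, since position n - 1 is one. *)
Definition fdes (n : nat) (e : {ffun 'I_n -> 'I_n}) : nat :=
  (find (fun p => (entry e p.+1 < entry e p)%R) (iota 0 n)).+1.

Definition rank (n : nat) (e : {ffun 'I_n -> 'I_n}) : int :=
  ((fdes e)%:Z - (max_entry e)%:Z - 1)%R.

(* For k > 0 this is the coefficient of x^j in C(x)^k, where C(x) is the
   generating function of the Catalan numbers. *)
Definition ballot (j k : nat) : rat :=
  (k%:R / (2 * j + k)%N%:R * 'C(2 * j + k, j)%:R)%R.

(* Main.v *)
(* A letter x can be appended to a word avoiding 102 and 210 exactly when
   z <= x <= y for every inversion (y, z) of the word.  So once a weakly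
   increasing prefix u with last (hence maximal) entry M drops to a, the letters
   allowed next form an interval [a, H], where H is the smallest entry of u above
   a, and the completions can be counted letter by letter.  Weakly increasing
   prefixes are counted by ballot numbers.  Deleting or lowering the last entry
   of the prefix turns the total, for fixed rank t, into sums over t of
   convolutions; these are evaluated by recurrences that translate, for the
   Catalan generating function C,
     1 - x - x C = C^-2   and   1 - 2 x - x C + x^2 C = C^-3. *)

Require Import Defs.
From HB Require Import structures.
From mathcomp Require Import all_boot all_order all_algebra.
From mathcomp Require Import zify ring lra.
Import Order.TTheory GRing.Theory Num.Theory.
Set Implicit Arguments.
Unset Strict Implicit.
Unset Printing Implicit Defensive.
Local Open Scope ring_scope.

(** * Ballot numbers: binomial form and recurrence *)

Lemma ballot_bin (j k : nat) :
  ballot j.+1 k = 'C(2 * j + k + 1, j.+1)%:R - 'C(2 * j + k + 1, j)%:R.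
Proof.
rewrite /ballot; set n := (2 * j.+1 + k)%N.
have -> : (2 * j + k + 1 = n.-1)%N by rewrite /n; lia.
have n0 : n%:R != 0 :> rat by rewrite pnatr_eq0 /n; lia.
apply: (mulfI n0); rewrite mulrA [n%:R * _]mulrC divfK // mulrBr -!natrM.
rewrite (mul_bin_diag n j) mul_bin_down !natrM natrB; last by rewrite /n; lia.
by rewrite -mulrBl; congr (_ * _); rewrite /n !natrD; ring.
Qed.

Lemma ballot0 (k : nat) : ballot 0 k.+1 = 1.
Proof. by rewrite /ballot muln0 add0n bin0 mulr1 divff // pnatr_eq0. Qed.

Lemma ballotS0 (j : nat) : ballot j.+1 0 = 0.
Proof. by rewrite /ballot mul0r mul0r. Qed.

(** Coefficientwise [C = 1 + x C^2], multiplied by [C^k]. *)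
Lemma ballotSS (j k : nat) : ballot j.+1 k.+1 = ballot j.+1 k + ballot j k.+2.
Proof.
rewrite !ballot_bin.
have -> : (2 * j + k.+1 + 1 = (2 * j + k + 1).+1)%N by lia.
case: j => [|j]; first by rewrite ballot0 !bin0 !binS bin0; ring.
rewrite ballot_bin.
have -> : (2 * j + k.+2 + 1 = 2 * j.+1 + k + 1)%N by lia.
by rewrite [in LHS]binS [in X in _ - X = _]binS !natrD; ring.
Qed.

(** * Convolutions over antidiagonals *)

Definition conv (V : zmodType) (y : nat) (f : nat -> nat -> V) : V :=
  \sum_(i < y.+1) f i (y - i)%N.

Lemma eq_conv (V : zmodType) y (f g : nat -> nat -> V) :
  (forall i j, (i + j = y)%N -> f i j = g i j) -> conv y f = conv y g.
Proof. by move=> fg; apply: eq_bigr => i _; apply: fg; have := ltn_ord i; lia. Qed.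

Lemma conv0 (V : zmodType) (f : nat -> nat -> V) : conv 0 f = f 0%N 0%N.
Proof. by rewrite /conv big_ord1. Qed.

Lemma convSl (V : zmodType) y (f : nat -> nat -> V) :
  conv y.+1 f = f 0%N y.+1 + conv y (fun i j => f i.+1 j).
Proof. by rewrite /conv big_ord_recl subn0. Qed.

Lemma convSr (V : zmodType) y (f : nat -> nat -> V) :
  conv y.+1 f = conv y (fun i j => f i j.+1) + f y.+1 0%N.
Proof.
rewrite /conv big_ord_recr /= subnn; congr (_ + _); apply: eq_bigr => i _.
by rewrite subSn // -ltnS.
Qed.

Lemma convD (V : zmodType) y (f g : nat -> nat -> V) :
  conv y (fun i j => f i j + g i j) = conv y f + conv y g.
Proof. exact: big_split. Qed.

Lemma convN (V : zmodType) y (f : nat -> nat -> V) :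
  conv y (fun i j => - f i j) = - conv y f.
Proof. exact: sumrN. Qed.

(** Both sides run over the triples [a + d + r = y]; grouping [d] with [r] lets the inner sum be
    treated for fixed [a]. *)
Lemma convA (V : zmodType) y (f : nat -> nat -> nat -> V) :
  conv y (fun i r => conv i (fun a d => f a d r)) =
  conv y (fun a i => conv i (fun d r => f a d r)).
Proof.
elim: y f => [|y IH] f; first by rewrite !conv0.
rewrite convSl [RHS]convSl -IH conv0 [in RHS]convSl -addrA; congr (_ + _).
by rewrite -convD; apply: eq_conv => i j _; rewrite convSl.
Qed.

(** * Extensions after a drop and their Catalan identities *)

(* Let [L, H] be the interval of letters allowed after a drop, and d = H - L.  If
   H is below the maximum M of the word, beta d m counts the extensions by m
   letters; if H = M, sigma d m does, since repeating M leaves the interval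
   unchanged.  The value sigma 0 m = 0 is a convention. *)
Fixpoint beta (d m : nat) : rat :=
  if m is m'.+1 then \sum_(i < d.+1) beta i m' else 1.

Lemma beta0 m : beta 0 m = 1.
Proof. by elim: m => //= m IH; rewrite big_ord1. Qed.

Lemma beta_r0 d : beta d 0 = 1.
Proof. by []. Qed.

Lemma betaSS d m : beta d.+1 m.+1 = beta d m.+1 + beta d.+1 m.
Proof. by rewrite /= big_ord_recr. Qed.

Fixpoint sigma (d m : nat) : rat :=
  if m is m'.+1 then sigma d m' + \sum_(i < d) sigma i.+1 m' else (0 < d)%:R.

Lemma sigma0 m : sigma 0 m = 0.
Proof. by elim: m => //= m IH; rewrite big_ord0 IH addr0. Qed.

(** Comparing the defining sums for [d.+1] and [d] leaves a recurrence of bounded length; for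
    [d > 0] the generating function in [m] is [(1 - x)^(d-1) / (1 - 2x)^d]. *)
Lemma sigmaSS d m :
  sigma d.+1 m.+1 = 2 * sigma d.+1 m + sigma d m.+1 - sigma d m.
Proof. by rewrite /= big_ord_recr /=; ring. Qed.

(* C^k \sum_d (x C)^d / (1 - x)^(d + 1) = C^k / (1 - x - x C) = C^(k + 2). *)
Lemma conv_beta y k :
  conv y (fun a i => conv i (fun d r => ballot a (d + k.+1) * beta d r)) =
  ballot y k.+3.
Proof.
pose E i a k : rat := conv i (fun d r => ballot a (d + k.+1) * beta d r).
have E0 a k' : E 0%N a k' = ballot a k'.+1.
  by rewrite /E conv0 beta0 mulr1.
(* One expansion of [1 / (1 - x - x C)]: by the Pascal rule [betaSS] either [r] or [d] loses one
   unit, and a unit of [d] carries a factor [C]. *)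
have ES i a k' : E i.+1 a k' = E i a k' + E i a k'.+1.
  case: i => [|i]; first by rewrite !E0 /E convSl conv0 !beta0 !mulr1.
  rewrite /E convSl convSr [X in _ = X + _]convSl [X in _ = _ + X]convSr.
  rewrite !beta0 !beta_r0 !addrA -[RHS]addrA [X in _ = _ + X]addrC.
  rewrite -!addrA; congr (_ + _); rewrite [RHS]addrCA addrC; congr (_ + _).
    by congr (ballot _ _ * _); lia.
  rewrite addrC -convD; apply: eq_conv => d r _.
  have -> : (d + k'.+2 = d.+1 + k'.+1)%N by lia.
  by rewrite -mulrDr -betaSS.
elim: y k => [|y IH] k; first by rewrite !conv0 beta0 mulr1 !ballot0.
rewrite convSr -/(E 0%N y.+1 k) E0.
transitivity (conv y (fun a i => E i a k + E i a k.+1) + ballot y.+1 k.+1).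
  by congr (_ + _); apply: eq_conv => a i _; rewrite -ES.
by rewrite convD !IH !ballotSS; ring.
Qed.

(* C^k \sum_d (x C)^d (1 - x)^d / (1 - 2x)^(d + 1)
     = C^k / (1 - 2x - x C + x^2 C) = C^(k + 3). *)
Lemma conv_sigma y k :
  conv y.+1 (fun a i => conv i (fun d r => ballot a (d + k) * sigma d r)) =
  ballot y k.+4.
Proof.
pose E i a k : rat := conv i (fun d r => ballot a (d + k) * sigma d r).
have E0 a k' : E 0%N a k' = 0 by rewrite /E conv0 sigma0 mulr0.
have E1 a k' : E 1%N a k' = ballot a k'.+1.
  by rewrite /E convSl conv0 sigma0 mulr0 add0r mulr1.
have ES i a k' : E i.+2 a k' = 2 * E i.+1 a k' + E i.+1 a k'.+1 - E i a k'.+1.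
  rewrite /E convSl sigma0 mulr0 add0r convSr.
  rewrite [in X in _ = 2 * X + _ - _]convSl sigma0 mulr0 add0r.
  rewrite [in X in _ = _ + X - _]convSr.
  rewrite [2 * _]mulr_natl mulr2n.
  rewrite [RHS]addrAC [RHS]addrA addSnnS; congr (_ + _); rewrite -convN -!convD.
  by apply: eq_conv => d r _; rewrite sigmaSS -addSnnS; ring.
(* [ES] reaches back two indices, so the induction carries two consecutive values of [y]. *)
suff [+ _] : conv y.+1 (fun a i => E i a k) = ballot y k.+4 /\
  conv y.+2 (fun a i => E i a k) = ballot y.+1 k.+4 by [].
have EC n k' : conv n.+1 (fun a i => E i a k') = conv n (fun a i => E i.+1 a k').
  by rewrite convSr E0 addr0.
elim: y k => [|y IH] k.
  by rewrite !EC convSr !conv0 !E1 ES !E1 E0 !ballotSS !ballot0; split => //; ring.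
split; first by case: (IH k).
rewrite !EC convSr E1.
transitivity (ballot y.+2 k.+1 + conv y.+1 (fun a i =>
    E i.+1 a k + E i.+1 a k + E i.+1 a k.+1 - E i a k.+1)).
  rewrite addrC; congr (_ + _); apply: eq_conv => a i _.
  by rewrite ES mulr_natl mulr2n.
rewrite !(convD, convN) -!EC (IH k).2 (IH k.+1).2 (IH k.+1).1 !ballotSS; ring.
Qed.

(** * Weakly increasing prefixes and their number *)

(* Weakly increasing inversion sequences; last 0 [::] = 0 makes k = 0 uniform. *)
Fixpoint weakinc (k : nat) : seq (seq nat) :=
  if k is k'.+1 then
    [seq rcons u x | u <- weakinc k', x <- index_iota (last 0%N u) k'.+1]
  else [:: [::]].

Lemma mem_weakinc k u : u \in weakinc k ->
  [/\ size u = k, sorted leq u & (last 0 u <= k.-1)%N].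
Proof.
elim: k u => [|k IH] u /=; first by rewrite inE => /eqP->.
case/allpairsPdep=> v [x [/IH[sv so _]]]; rewrite mem_index_iota => /andP[lx xk] ->.
split; rewrite ?size_rcons ?sv ?last_rcons //.
case: v so lx {IH sv} => //= y v.
by rewrite rcons_path => ->.
Qed.

Lemma sum_weakincS k (P : pred (seq nat)) (f : seq nat -> rat) :
  \sum_(u <- weakinc k.+1 | P u) f u =
  \sum_(u <- weakinc k) \sum_(last 0%N u <= x < k.+1 | P (rcons u x)) f (rcons u x).
Proof.
rewrite big_mkcond big_allpairs_dep /=; apply: eq_bigr => u _.
by rewrite -big_mkcond.
Qed.

Lemma sum_weakinc_last_eq k x (f : seq nat -> rat) :
  \sum_(u <- weakinc k.+1 | last 0%N u == x) f u =
  if (x <= k)%N then \sum_(u <- weakinc k | (last 0 u <= x)%N) f (rcons u x) else 0.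
Proof.
rewrite sum_weakincS; transitivity (\sum_(u <- weakinc k)
    if (last 0 u <= x)%N && (x <= k)%N then f (rcons u x) else 0).
  apply: eq_bigr => u _; under eq_bigl => i do rewrite last_rcons.
  by rewrite big_nat1_eq ltnS.
case: leqP => _; last by under eq_bigr => u _ do rewrite andbF; rewrite big1_eq.
by under eq_bigr => u _ do rewrite andbT; rewrite -big_mkcond.
Qed.

Lemma sum_last_leS (s : seq (seq nat)) x (f : seq nat -> rat) :
  \sum_(u <- s | (last 0 u <= x.+1)%N) f u =
  \sum_(u <- s | (last 0 u <= x)%N) f u + \sum_(u <- s | last 0%N u == x.+1) f u.
Proof.
rewrite (bigID (fun u => last 0 u <= x)%N) /=; congr (_ + _); apply: eq_bigl => u; lia.
Qed.

Lemma sum_last_le0 (s : seq (seq nat)) (f : seq nat -> rat) :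
  \sum_(u <- s | (last 0 u <= 0)%N) f u = \sum_(u <- s | last 0%N u == 0%N) f u.
Proof. by apply: eq_bigl => u; rewrite leqn0. Qed.

Definition low (k a : nat) : rat := \sum_(u <- weakinc k | (last 0 u <= a)%N) 1.

Lemma lowS0 k : low k.+1 0 = low k 0.
Proof. by rewrite /low sum_last_le0 sum_weakinc_last_eq. Qed.

Lemma lowSS k a :
  low k.+1 a.+1 = low k.+1 a + (if (a < k)%N then low k a.+1 else 0).
Proof. by rewrite /low sum_last_leS sum_weakinc_last_eq. Qed.

(** The recurrences [lowS0] and [lowSS] are those of the ballot numbers. *)
Lemma lowE k a : (a <= k)%N -> low k a = ballot a (k - a).+1.
Proof.
elim: k a => [|k IH] [|a] // ak.
- by rewrite /low /= big_cons big_nil addr0 ballot0.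
- by rewrite lowS0 IH // !ballot0.
elim: a ak => [|a IHa] ak; rewrite lowSS.
  rewrite lowS0 IH //; case: ltnP => k0; last first.
    have -> : k = 0%N by lia.
    by rewrite ballotSS ballotS0 !ballot0; ring.
  by rewrite IH // !ballot0 [RHS]ballotSS ballot0 addrC; congr (ballot _ _ + _); lia.
rewrite IHa; last by lia.
(* When [a.+2] equals the length, the term of length [k] is absent, in accordance with
   [ballot a.+2 0 = 0]. *)
case: ltnP => ka; last first.
  have -> : (k.+1 - a.+2 = 0)%N by lia.
  have -> : (k.+1 - a.+1 = 1)%N by lia.
  by rewrite [RHS]ballotSS ballotS0 addrC.
rewrite IH // [RHS]ballotSS addrC; congr (ballot _ _ + ballot _ _); lia.
Qed.

(** * Drops after a weakly increasing prefix *)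

(* Junk value 0 when no entry exceeds a. *)
Definition next_above (u : seq nat) (a : nat) : nat := nth 0%N u (find (ltn a) u).

Lemma has_ltn_weakinc k u a : u \in weakinc k -> has (ltn a) u = (a < last 0 u)%N.
Proof.
case/mem_weakinc=> _ so _; apply/hasP/idP => [[y yu ay]|al]; last first.
  exists (last 0%N u) => //; case: u al {so} => //= y u _; exact: mem_last.
apply: leq_trans ay _; case/lastP: u so yu => // u x; rewrite last_rcons.
rewrite (sorted_pairwise leq_trans) pairwise_rcons => /andP[/allP ux _].
by rewrite mem_rcons inE => /predU1P[->//|/ux].
Qed.

Lemma next_above_rcons_lt k u a x : u \in weakinc k -> (a < last 0 u)%N ->
  next_above (rcons u x) a = next_above u a.
Proof.
move=> uk; rewrite -(has_ltn_weakinc _ uk) => h.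
by rewrite /next_above -cats1 find_cat h nth_cat -has_find h.
Qed.

Lemma next_above_rcons_ge k u a x : u \in weakinc k -> (last 0 u <= a < x)%N ->
  next_above (rcons u x) a = x.
Proof.
move=> uk /andP[la ax].
have h : has (ltn a) u = false by rewrite (has_ltn_weakinc _ uk) ltnNge la.
by rewrite /next_above -cats1 find_cat h /= ax addn0 nth_cat ltnn subnn.
Qed.

(* What a strictly larger last entry appended to u would turn the drops of u
   into; see omega_rcons. *)
Definition psi (r : nat) (u : seq nat) : rat :=
  \sum_(0 <= a < last 0%N u) beta (next_above u a - a) r.

(** In the second branch the smallest entry above [a] is the last, maximal one; this is the case
    [H = M] of [sigma]. *)
Definition drops (r : nat) (u : seq nat) (a : nat) : rat :=
  if (next_above u a < last 0 u)%N then beta (next_above u a - a) r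
  else sigma (last 0%N u - a) r.

(* The number of ways to drop after u and then append r letters. *)
Definition omega (r : nat) (u : seq nat) : rat :=
  \sum_(0 <= a < last 0%N u) drops r u a.

Lemma next_above_le k u a : u \in weakinc k -> (a < last 0 u)%N ->
  (a < next_above u a <= last 0 u)%N.
Proof.
move=> uk al; have h : has (ltn a) u by rewrite (has_ltn_weakinc _ uk).
have := nth_find 0%N h; rewrite -/(next_above u a) /= => -> /=.
have : ~~ has (ltn (last 0%N u)) u by rewrite (has_ltn_weakinc _ uk) ltnn.
rewrite -all_predC => /allP/(_ (next_above u a)) /=; rewrite -leqNgt; apply.
by rewrite mem_nth // -has_find.
Qed.

(** Below the last entry of [u] the smallest larger entry is already in [u]; from there up to [x] it
    is [x] itself. *)
Lemma psi_rcons k u r x : u \in weakinc k -> (last 0 u <= x)%N ->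
  psi r (rcons u x) = psi r u + \sum_(last 0%N u <= a < x) beta (x - a) r.
Proof.
move=> uk ux; rewrite /psi last_rcons (big_cat_nat (leq0n _) ux) /=.
congr (_ + _); rewrite big_nat [RHS]big_nat; apply: eq_bigr => a ha.
  by rewrite (next_above_rcons_lt _ uk).
by rewrite (next_above_rcons_ge uk).
Qed.

Lemma omega_rcons_last k u r : u \in weakinc k ->
  omega r (rcons u (last 0%N u)) = omega r u.
Proof.
move=> uk; rewrite /omega last_rcons big_nat [RHS]big_nat.
by apply: eq_bigr => a ha; rewrite /drops last_rcons (next_above_rcons_lt _ uk).
Qed.

(** For [a] below the last entry of [u], the smallest larger entry lies in [u], hence below the new
    maximum [x], and [beta] applies. For the other [a] it is [x], and [sigma] applies. *)
Lemma omega_rcons k u r x : u \in weakinc k -> (last 0 u < x)%N ->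
  omega r (rcons u x) = psi r u + \sum_(last 0%N u <= a < x) sigma (x - a) r.
Proof.
move=> uk ux; rewrite /omega last_rcons (big_cat_nat (leq0n _) (ltnW ux)) /=.
congr (_ + _); rewrite big_nat [RHS]big_nat; apply: eq_bigr => a ha.
  rewrite /drops (next_above_rcons_lt _ uk) // last_rcons.
  by case/andP: (next_above_le uk ha) => _ h; rewrite (leq_ltn_trans h ux).
by rewrite /drops last_rcons (next_above_rcons_ge uk) // ltnn.
Qed.

(** After exchanging the sums, each [a] is weighted by the number of prefixes ending at or below it;
    [a < x] absorbs the bound [x]. *)
Lemma sum_weakinc_low k x (g : nat -> rat) :
  \sum_(u <- weakinc k | (last 0 u <= x)%N) \sum_(last 0%N u <= a < x) g a =
  \sum_(0 <= a < x) low k a * g a.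
Proof.
under eq_bigr => u ux do rewrite (big_nat_widenl _ _ _ _ _ (leq0n (last 0%N u))).
rewrite (exchange_big_dep xpredT) //= big_nat [RHS]big_nat.
apply: eq_bigr => a /andP[_ ax]; rewrite /low big_distrl /=.
rewrite [LHS]big_mkcond [RHS]big_mkcond; apply: eq_bigr => u _ /=.
case: (leqP (last _ u) a) => h; rewrite ?andbF ?mul1r //.
by rewrite (leq_trans h (ltnW ax)).
Qed.

(** * Recurrences for sums over prefixes *)

Definition Psi r k x : rat := \sum_(u <- weakinc k | (last 0 u <= x)%N) psi r u.

Definition Omega r k x : rat := \sum_(u <- weakinc k | last 0%N u == x) omega r u.

Lemma psi_last0 r u : last 0%N u = 0%N -> psi r u = 0.
Proof. by rewrite /psi => ->; rewrite big_nil. Qed.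

Lemma omega_last0 r u : last 0%N u = 0%N -> omega r u = 0.
Proof. by rewrite /omega => ->; rewrite big_nil. Qed.

Lemma Psi0 r k : Psi r k 0 = 0.
Proof. by apply: big1 => u; rewrite leqn0 => /eqP/psi_last0. Qed.

Lemma Omega0 r k : Omega r k 0 = 0.
Proof. by apply: big1 => u /eqP/omega_last0. Qed.

Lemma Omega_out r k x : (k <= x)%N -> Omega r k x = 0.
Proof.
case: x => [|x] kx; first exact: Omega0.
rewrite /Omega big_seq_cond big1 // => u /andP[/mem_weakinc[_ _ h] /eqP hx]; lia.
Qed.

Lemma Psi_out r k x : (k <= x.+1)%N -> Psi r k x.+1 = Psi r k x.
Proof.
move=> kx; rewrite /Psi sum_last_leS [X in _ + X]big_seq_cond [X in _ + X]big1 ?addr0 //.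
by move=> u /andP[/mem_weakinc[_ _ h] /eqP hx]; lia.
Qed.

(** Either the last entry is at most [x], or it equals [x.+1] and is deleted. *)
Lemma PsiSS r k x : (x < k)%N ->
  Psi r k.+1 x.+1 = Psi r k.+1 x + Psi r k x.+1
    + \sum_(0 <= a < x.+1) low k a * beta (x.+1 - a) r.
Proof.
move=> xk; rewrite /Psi sum_last_leS sum_weakinc_last_eq xk -addrA; congr (_ + _).
rewrite -sum_weakinc_low -big_split big_seq_cond [RHS]big_seq_cond.
by apply: eq_bigr => u /andP[uk ux]; rewrite (psi_rcons _ uk).
Qed.

(** The last entry [x.+1] is deleted. Prefixes still ending in [x.+1] keep their [omega]; those
    ending lower give the [Psi] term and the [sigma] sum. *)
Lemma OmegaSS r k x : (x < k)%N ->
  Omega r k.+1 x.+1 = Omega r k x.+1 + Psi r k x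
    + \sum_(0 <= a < x.+1) low k a * sigma (x.+1 - a) r.
Proof.
move=> xk; rewrite /Omega sum_weakinc_last_eq xk sum_last_leS addrC -addrA.
congr (_ + _).
  by rewrite big_seq_cond [RHS]big_seq_cond; apply: eq_bigr => u /andP[uk /eqP <-];
    rewrite (omega_rcons_last _ uk).
rewrite -sum_weakinc_low sum_last_leS [X in _ + (_ + X)]big1 ?addr0; last first.
  by move=> u /eqP->; rewrite big_geq.
rewrite -big_split big_seq_cond [RHS]big_seq_cond.
by apply: eq_bigr => u /andP[uk ux]; rewrite (omega_rcons _ uk).
Qed.

(** * Evaluation of the convolutions at fixed rank *)

(** By [lowE] this is a triple convolution in [a], [d = x - a] and [r]. The range [a < x] omits
    [d = 0], hence the subtracted term. *)
Lemma conv_low (g : nat -> nat -> rat) y h : 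
  conv y (fun x r => \sum_(0 <= a < x) low (x + h) a * g (x - a)%N r) =
  conv y (fun x r => conv x (fun a d => ballot a (d + h.+1) * g d r))
  - conv y (fun x r => ballot x h.+1 * g 0%N r).
Proof.
rewrite -convN -convD; apply: eq_conv => x r _; rewrite /conv big_ord_recr /=.
rewrite subnn addrK big_mkord; apply: eq_bigr => a _; rewrite lowE.
  by congr (ballot _ _ * _); have := ltn_ord a; lia.
by have := ltn_ord a; lia.
Qed.

(** [C^(h+3) - C^(h+1) / (1 - x) = x C^(h+4) / (1 - x)], a form of [1 - x - x C = C^-2]. *)
Lemma conv_low_beta y h :
  conv y (fun x r => \sum_(0 <= a < x) low (x + h) a * beta (x - a) r) =
  \sum_(0 <= i < y) ballot i h.+4.
Proof.
rewrite (conv_low beta) convA conv_beta.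
under [X in _ - X]eq_conv => x r _ do rewrite beta0 mulr1.
rewrite /conv; elim: y => [|y IH].
  by rewrite big_ord1 big_geq // !ballot0 subrr.
rewrite big_ord_recr big_nat_recr //= -IH !ballotSS; ring.
Qed.

Lemma conv_low_sigma y h :
  conv y.+1 (fun x r => \sum_(0 <= a < x) low (x + h) a * sigma (x - a) r) =
  ballot y (h + 5).
Proof.
rewrite (conv_low sigma) convA conv_sigma [X in _ - X]big1.
  by rewrite subr0 !addnS addn0.
by move=> i _; rewrite sigma0 mulr0.
Qed.

(** The summand of [conv_Psi] obeys the recurrence of the [Psi] convolutions, with the [ballot] term
    coming from [conv_low_beta]; [bin_ballot_base] is the boundary case. *)
Lemma bin_ballot_step i t :
  t.+3%:R * 'C(2 * i.+1 + t.+1 + 4, i.+1)%:R - ballot i.+1 (t.+1 + 5) =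
  (t.+4%:R * 'C(2 * i + t.+2 + 4, i)%:R - ballot i (t.+2 + 5))
  + (t.+2%:R * 'C(2 * i.+1 + t + 4, i.+1)%:R - ballot i.+1 (t + 5))
  + ballot i.+1 (t + 5).
Proof.
have -> : (2 * i.+1 + t.+1 + 4 = (2 * i + (t + 5) + 1).+1)%N by lia.
have -> : (2 * i.+1 + t + 4 = 2 * i + (t + 5) + 1)%N by lia.
have -> : (2 * i + t.+2 + 4 = 2 * i + (t + 5) + 1)%N by lia.
have -> : (t.+1 + 5 = (t + 5).+1)%N by lia.
have -> : (t.+2 + 5 = (t + 5).+2)%N by lia.
rewrite ballotSS ballot_bin binS -!natr1 !natrD; ring.
Qed.

Lemma bin_ballot5 i :
  'C(2 * i + 4 + 1, i)%:R = 2 * 'C(2 * i + 4, i)%:R - ballot i 5.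
Proof.
case: i => [|i]; first by rewrite !bin0 ballot0; ring.
rewrite ballot_bin addn1 binS natrD.
have -> : (2 * i + 5 + 1 = 2 * i.+1 + 4)%N by lia.
ring.
Qed.

Lemma bin_ballot_base i :
  2 * 'C(2 * i.+1 + 4, i.+1)%:R - ballot i.+1 5 =
  (3 * 'C(2 * i + 4 + 1, i)%:R - ballot i 6)
  + (2 * 'C(2 * i + 4, i)%:R - ballot i 5) + ballot i.+1 4.
Proof.
have -> : (2 * i.+1 + 4 = (2 * i + 4 + 1).+1)%N by lia.
rewrite ballotSS ballot_bin binS natrD bin_ballot5; ring.
Qed.

Lemma conv_Psi y t :
  conv y (fun x r => Psi r (x + t).+1 x) =
  \sum_(0 <= i < y) (t.+2%:R * 'C(2 * i + t + 4, i)%:R - ballot i (t + 5)).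
Proof.
(* The offset [s] is the length minus the bound minus 1. Lowering the bound raises it by one,
   deleting the last entry lowers it by one; hence an induction on [y], then on [t]. *)
have step z s : conv z.+1 (fun x r => Psi r (x + s).+1 x) =
    conv z (fun x r => Psi r (x + s.+1).+1 x)
    + conv z (fun x r => Psi r (x + s).+1 x.+1)
    + conv z.+1 (fun x r => \sum_(0 <= a < x) low (x + s) a * beta (x - a) r).
  rewrite convSl Psi0 add0r [X in _ + X]convSl big_geq // add0r -!convD.
  apply: eq_conv => x r _; rewrite addSn PsiSS; last by lia.
  by rewrite addnS.
elim: y t => [|y IHy]; first by move=> t; rewrite conv0 Psi0 big_geq.
elim=> [|t IHt].
  rewrite step conv_low_beta IHy.
  (* Deletion at offset 0 would give offset -1, but a prefix of length [x.+1] ends at or below [x],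
     so offset 0 returns. *)
  under [X in _ + X + _]eq_conv => x r _ do rewrite addn0 Psi_out // -[x in x.+1]addn0.
  rewrite IHy !big_nat_recl //= !bin0 !ballot0.
  under [X in _ = _ + X]eq_bigr => i _ do rewrite addn0 add0n bin_ballot_base.
  under [X in X + _ + _ = _]eq_bigr => i _ do rewrite addnAC.
  under [X in _ + X + _ = _]eq_bigr => i _ do rewrite addn0 add0n.
  by rewrite !big_split /=; ring.
rewrite step conv_low_beta IHy.
(* The middle term of [step] is the convolution for [y.+1] and [t] without its vanishing first
   summand. *)
have := IHt; rewrite convSl Psi0 add0r => IHt'.
under [X in _ + X + _]eq_conv => x r _ do rewrite addnS -addSn.
rewrite IHt' !big_nat_recl //= !bin0 !ballot0.
under [X in _ = _ + X]eq_bigr => i _ do rewrite bin_ballot_step.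
under [X in _ + (_ + X) = _]eq_bigr => i _ do rewrite -addn4 addSnnS.
by rewrite !big_split /= -[t.+3%:R]natr1 [(t + 5)%N]addnS ballot0; ring.
Qed.

Lemma conv_Omega y t :
  conv y (fun x r => Omega r (x + t).+1 x) =
  t.+1%:R * \sum_(0 <= i < y) 'C(2 * i + t + 3, i)%:R
  + \sum_(0 <= i < y.-1) (ballot i (t + 6) - ballot i 5).
Proof.
case: y => [|y]; first by rewrite conv0 Omega0 !big_geq // mulr0 addr0.
have step s : conv y.+1 (fun x r => Omega r (x + s).+1 x) =
    conv y (fun x r => Omega r (x + s).+1 x.+1)
    + \sum_(0 <= i < y) (s.+2%:R * 'C(2 * i + s + 4, i)%:R - ballot i (s + 5))
    + ballot y (s + 5).
  rewrite -conv_Psi -conv_low_sigma convSl Omega0 add0r.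
  rewrite [X in _ + X]convSl big_geq // add0r -!convD.
  by apply: eq_conv => x r _; rewrite addSn OmegaSS //; lia.
elim: t => [|t IHt]; rewrite step /=.
  (* No prefix of length [x.+1] ends in [x.+1]. *)
  rewrite [X in X + _ + _]big1 ?add0r; last by move=> x _; rewrite Omega_out // addn0.
  elim: {step} y => [|y IHy]; first by rewrite !big_nat1 !big_geq // bin0 ballot0; ring.
  rewrite big_nat_recr // [in RHS]big_nat_recr // [X in _ = _ + X]big_nat_recr //=.
  move: IHy; set a := \sum_(_ <= _ < _) _; set b := \sum_(_ <= _ < _) _.
  set c := \sum_(_ <= _ < _) _ => IHy.
  have -> : a = b + c - ballot y 5 by rewrite -[b]mul1r -IHy add0n addrK.
  have -> : (2 * y.+1 + 0 + 3 = 2 * y + 4 + 1)%N by lia.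
  by rewrite addn0 add0n ballotSS ballot_bin -bin_ballot5; ring.
have := IHt; rewrite convSl Omega0 add0r => IHt'.
under [X in X + _ + _]eq_conv => x r _ do rewrite addnS -addSn.
rewrite IHt' /=.
(* What remains is an identity between closed forms, checked by increments in [y]. *)
elim: {step IHt IHt'} y => [|y IHy].
  rewrite !big_nat1 !big_geq // !bin0 [(t.+1 + 5)%N]addnS ballot0.
  by rewrite -[t.+2%:R]natr1; ring.
rewrite !(big_nat_recr y.+1) // !(big_nat_recr y) //= in IHy *.
have t5 : (t.+1 + 5 = (t + 4).+2)%N by lia.
have t6 : (t + 6 = (t + 4).+2)%N by lia.
have t7 : (t.+1 + 6 = (t + 4).+3)%N by lia.
rewrite t5 t6 t7 in IHy *.
have -> : (2 * y.+1 + t.+1 + 3 = (2 * y + (t + 4) + 1).+1)%N by lia.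
have -> : (2 * y.+1 + t + 3 = 2 * y + (t + 4) + 1)%N by lia.
have -> : (2 * y + t.+1 + 4 = 2 * y + (t + 4) + 1)%N by lia.
rewrite !ballotSS ballot_bin binS -!natr1 !natrD in IHy *.
lra.
Qed.

(** * Avoidance, first descent and rank, letter by letter *)

(* That w extended by x contains neither 102 nor 210 with x as last letter. *)
Definition admits (w : seq nat) (x : nat) : bool :=
  pairwise (fun y z => (z < y) ==> (z <= x <= y))%N w.

Lemma admits_rcons w z x :
  admits (rcons w z) x = all (fun y => (z < y) ==> (z <= x <= y))%N w && admits w x.
Proof. exact: pairwise_rcons. Qed.

Lemma admits_sorted w x : sorted leq w -> admits w x.
Proof.
rewrite (sorted_pairwise leq_trans); apply: sub_pairwise => y z yz.
by rewrite ltnNge yz.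
Qed.

Definition valid (w : seq nat) : bool :=
  all (fun i => (nth 0 w i <= i)%N && admits (take i w) (nth 0%N w i))
      (iota 0 (size w)).

Lemma valid_rcons w x : valid (rcons w x) = [&& valid w, (x <= size w)%N & admits w x].
Proof.
rewrite /valid size_rcons -addn1 iotaD all_cat /= andbT nth_rcons ltnn eqxx.
congr (_ && _); last by rewrite -cats1 take_size_cat.
apply: eq_in_all => i; rewrite mem_iota => /andP[_ iw].
by rewrite nth_rcons iw -cats1 takel_cat // ltnW.
Qed.

Lemma valid_take w i : valid w -> valid (take i w).
Proof.
elim/last_ind: w => // w x IH; rewrite valid_rcons => /and3P[gw xw okw].
case: (leqP i (size w)) => h; first by rewrite -cats1 takel_cat ?IH.
by rewrite take_oversize ?size_rcons // valid_rcons gw xw.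
Qed.

(** The end of the word counts as a descent, as does the conventional entry -1 there. *)
Fixpoint fdes_path (x : nat) (w : seq nat) : nat :=
  if w is y :: w' then if (y < x)%N then 1%N else (fdes_path y w').+1 else 1%N.

Definition fdes_seq (w : seq nat) : nat := if w is x :: w' then fdes_path x w' else 1%N.

Lemma fdes_rcons w x : ~~ sorted leq w -> fdes_seq (rcons w x) = fdes_seq w.
Proof.
case: w => //= y w; elim: w y => //= z w IH y.
by case: ltnP => //= _ /IH->.
Qed.

Lemma fdes_sorted w : w != [::] -> sorted leq w -> fdes_seq w = size w.
Proof.
case: w => //= y w _; elim: w y => //= z w IH y /andP[yz /IH->].
by rewrite ltnNge yz.
Qed.

Lemma fdes_drop w x : sorted leq w -> (x < last 0 w)%N -> fdes_seq (rcons w x) = size w.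
Proof.
case: w => //= y w; elim: w y => [|z w IH] y /=; first by move=> _ ->.
by move=> /andP[yz /IH h] /h->; rewrite ltnNge yz.
Qed.

Definition has_rank (t : nat) (w : seq nat) : bool :=
  fdes_seq w == (\max_(x <- w) x + t.+1)%N.

Lemma max_seqE (w : seq nat) M : M \in w -> all (geq M) w -> \max_(x <- w) x = M.
Proof.
move=> Mw /allP wM; apply/eqP; rewrite eqn_leq; apply/andP; split.
  by apply/bigmax_leqP_seq => x /wM.
exact: leq_bigmax_seq.
Qed.

Lemma max_rcons (w : seq nat) x :
  \max_(y <- rcons w x) y = maxn (\max_(y <- w) y) x.
Proof. by rewrite -cats1 big_cat big_seq1. Qed.

(** After the first drop, letters up to the maximum change neither the first descent nor the
    maximum. *)
Lemma has_rank_rcons t w x : ~~ sorted leq w -> (x <= \max_(y <- w) y)%N ->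
  has_rank t (rcons w x) = has_rank t w.
Proof.
by move=> sw xw; rewrite /has_rank fdes_rcons // max_rcons (maxn_idPl xw).
Qed.

(** * Counting the extensions of a word *)

(* The number of extensions of w by r letters that have rank t. *)
Fixpoint ext (t r : nat) (w : seq nat) : rat :=
  if r is r'.+1 then \sum_(0 <= x < (size w).+1 | admits w x) ext t r' (rcons w x)
  else (has_rank t w)%:R.

Lemma sum_window (L H n : nat) (g : nat -> rat) : (H <= n)%N ->
  \sum_(0 <= x < n.+1 | (L <= x <= H)%N) g x = \sum_(L <= x < H.+1) g x.
Proof.
by move=> Hn; rewrite [RHS](big_nat_widenl _ 0) // [RHS](big_nat_widen _ _ n.+1) //.
Qed.

Lemma sum_nat_rev (L H : nat) (g : nat -> rat) :
  \sum_(L <= x < H) g (H - x)%N = \sum_(i < H - L) g i.+1.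
Proof.
rewrite big_nat_rev /= -{1}[L]add0n big_addn big_mkord; apply: eq_bigr => i _.
by congr g; have := ltn_ord i; lia.
Qed.

Lemma sorted_rconsN w x : ~~ sorted leq w -> ~~ sorted leq (rcons w x).
Proof. by apply: contra; rewrite -cats1 => /cat_sorted2[]. Qed.

(** The new inversion [(H, x)] raises the lower bound to [x]. As no entry lies strictly between [L]
    and [H], all entries above [x] are at least [H], so the upper bound stays. *)
Lemma admits_rcons_lt w L H x : (forall y, admits w y = (L <= y <= H)%N) -> H \in w ->
  ~~ has (fun y => L < y < H)%N w -> (L <= x < H)%N ->
  (forall y, admits (rcons w x) y = (x <= y <= H)%N) /\
  ~~ has (fun y => x < y < H)%N (rcons w x).
Proof.
move=> okw Hw gap /andP[Lx xH]; split.
  move=> y; rewrite admits_rcons okw; apply/andP/idP.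
    by case=> /allP/(_ _ Hw); rewrite xH.
  move=> /andP[xy yH]; split; last by rewrite yH (leq_trans Lx).
  apply/allP => z zw; apply/implyP => xz; rewrite xy (leq_trans yH) // leqNgt.
  by apply: contra gap => zH; apply/hasP; exists z; rewrite ?zH ?(leq_ltn_trans Lx).
rewrite has_rcons ltnn /=; apply: contra gap => /hasP[z zw /andP[xz zH]].
by apply/hasP; exists z; rewrite ?zH ?(leq_ltn_trans Lx).
Qed.

(** Appending [x] leaves the interval [[x, H]], so each width from 0 to [H - L] occurs once, as in
    [beta]. *)
Lemma ext_beta t r w L H : ~~ sorted leq w -> (\max_(y <- w) y <= size w)%N ->
  (forall x, admits w x = (L <= x <= H)%N) -> (L <= H < \max_(y <- w) y)%N ->
  \max_(y <- w) y \in w ->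
  H \in w -> ~~ has (fun y => L < y < H)%N w ->
  ext t r w = (has_rank t w)%:R * beta (H - L) r.
Proof.
elim: r w L => [|r IH] w L nsw Mw okw /andP[LH HM] MM Hw gap; first by rewrite mulr1.
rewrite /=; under eq_bigl => x do rewrite okw.
rewrite sum_window; last by lia.
transitivity ((has_rank t w)%:R * \sum_(L <= x < H.+1) beta (H.+1 - x).-1 r); last first.
  by congr (_ * _); rewrite (sum_nat_rev L H.+1 (fun i => beta i.-1 r)) subSn.
rewrite big_distrr /= big_nat [RHS]big_nat; apply: eq_bigr => x.
rewrite ltnS => /andP[Lx xH].
have xM : (x <= \max_(y <- w) y)%N by lia.
have mx : \max_(y <- rcons w x) y = \max_(y <- w) y.
  by rewrite max_rcons (maxn_idPl xM).
rewrite -(has_rank_rcons t nsw xM) subSn //=; case: (ltnP x H) => xH'.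
  have [okw' gap'] := admits_rcons_lt okw Hw gap (introT andP (conj Lx xH')).
  apply: IH; rewrite ?sorted_rconsN ?mx ?size_rcons ?xH //; first exact: leqW.
    by rewrite mem_rcons inE MM orbT.
  by rewrite mem_rcons inE Hw orbT.
(* [H] forms an inversion with the larger maximum, which leaves [H] as the only next letter. *)
have -> : x = H by lia.
apply: IH; rewrite ?sorted_rconsN -?mx ?size_rcons ?leqnn //.
- by rewrite (_ : H = x) ?mx; lia.
- by move=> y; rewrite admits_rcons okw; apply/andP/idP; 
   [case=> /allP/(_ _ MM); lia|move=> hy; split; [apply/allP => z _; lia | lia]].
- by rewrite (_ : H = x) ?mx; lia.
- by rewrite (_ : H = x) ?mx ?mem_rcons ?inE ?MM ?orbT; lia.
- by rewrite mem_rcons inE eqxx.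
by apply/hasPn => z _; lia.
Qed.

(** Repeating the maximum keeps the interval, which is the first term of [sigma]; a smaller letter
    [x] becomes the new lower end, at positive distance from the maximum. *)
Lemma ext_sigma t r w L : ~~ sorted leq w -> (\max_(y <- w) y <= size w)%N ->
  (forall x, admits w x = (L <= x <= \max_(y <- w) y)%N) -> (L < \max_(y <- w) y)%N ->
  \max_(y <- w) y \in w ->
  ~~ has (fun y => L < y < \max_(y <- w) y)%N w ->
  ext t r w = (has_rank t w)%:R * sigma (\max_(y <- w) y - L) r.
Proof.
elim: r w L => [|r IH] w L nsw Mw okw LM MM gap.
  by rewrite /= subn_gt0 LM mulr1.
rewrite [LHS]/=; under eq_bigl => x do rewrite okw.
rewrite sum_window // big_nat_recr /=; last exact: ltnW.
set M := \max_(y <- w) y in Mw okw LM MM gap *.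
rewrite mulrDr addrC; congr (_ + _).
  have mx : \max_(y <- rcons w M) y = M by rewrite max_rcons maxnn.
  rewrite -(has_rank_rcons t nsw (leqnn M)); have := IH (rcons w M) L; rewrite mx.
  apply; rewrite ?sorted_rconsN ?size_rcons //; first exact: leqW.
  - move=> y; rewrite admits_rcons -okw andbC; case: (admits w y) => //=.
    apply/allP => z zw; rewrite ltnNge /M; apply/implyP => /negP[].
    exact: leq_bigmax_seq.
  - by rewrite mem_rcons inE eqxx.
  by rewrite has_rcons ltnn andbF.
rewrite -(sum_nat_rev L M (fun i => sigma i r)) big_distrr /= big_nat [RHS]big_nat.
apply: eq_bigr => x /andP[Lx xM].
have mx : \max_(y <- rcons w x) y = M by rewrite max_rcons (maxn_idPl (ltnW xM)).
have [okw' gap'] := admits_rcons_lt okw MM gap (introT andP (conj Lx xM)).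
rewrite -(has_rank_rcons t nsw (ltnW xM)); have := IH (rcons w x) x; rewrite mx.
apply; rewrite ?sorted_rconsN ?size_rcons //; first exact: leqW.
by rewrite mem_rcons inE MM orbT.
Qed.

Lemma max_weakinc k u : u \in weakinc k.+1 ->
  last 0%N u \in u /\ \max_(y <- u) y = last 0%N u.
Proof.
move=> uk; have lu : last 0%N u \in u.
  by case: u uk => [/mem_weakinc[]|y u _] //=; exact: mem_last.
split=> //; apply: max_seqE => //; rewrite -[all _ _]negbK -has_predC.
rewrite (@eq_has _ _ (ltn (last 0%N u))); first by rewrite (has_ltn_weakinc _ uk) ltnn.
by move=> y /=; rewrite ltnNge.
Qed.

Lemma has_rank_weakinc t k u : u \in weakinc k.+1 ->
  has_rank t u = (k.+1 == last 0%N u + t.+1)%N.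
Proof.
move=> uk; have [su so _] := mem_weakinc uk; have [_ mx] := max_weakinc uk.
by rewrite /has_rank mx fdes_sorted ?su // -size_eq0 su.
Qed.

Lemma next_above_min k u a y : u \in weakinc k -> y \in u -> (a < y)%N ->
  (next_above u a <= y)%N.
Proof.
move=> uk yu ay; have [_ so _] := mem_weakinc uk; rewrite /next_above.
have h : has (ltn a) u by apply/hasP; exists y.
rewrite -[y in (_ <= y)%N](nth_index 0%N yu).
apply: (sorted_leq_nth leq_trans leqnn) => //.
- by rewrite inE -has_find.
- by rewrite inE index_mem.
rewrite leqNgt; apply/negP => /(before_find 0%N) /=.
by rewrite nth_index // ay.
Qed.

(** Only inversions ending in [a] constrain the next letter: it ranges from [a] to the smallest
    entry above [a]. The drop also fixes the rank. *)
Lemma ext_drop t r k u a : u \in weakinc k -> (a < last 0 u)%N ->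
  ext t r (rcons u a) = if (k == last 0%N u + t.+1)%N then drops r u a else 0.
Proof.
case: k => [|k] uk al; first by have [/size0nil us] := mem_weakinc uk; rewrite us in al.
have [su so lk] := mem_weakinc uk; have [lu mx] := max_weakinc uk.
have /andP[an nl] := next_above_le uk al.
have nu : next_above u a \in u by rewrite mem_nth // -has_find (has_ltn_weakinc _ uk).
have mx' : \max_(y <- rcons u a) y = last 0%N u.
  by rewrite max_rcons mx (maxn_idPl (ltnW al)).
have rkE : has_rank t (rcons u a) = (k.+1 == last 0%N u + t.+1)%N.
  by rewrite /has_rank mx' fdes_drop // su.
have nso : ~~ sorted leq (rcons u a).
  apply/negP; case: u al {uk su so lk lu mx an nl nu mx' rkE} => //= y u al.
  by rewrite rcons_path leqNgt al andbF.
have okE x : admits (rcons u a) x = (a <= x <= next_above u a)%N.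
  rewrite admits_rcons admits_sorted // andbT; apply/allP/idP.
    by move=> /(_ _ nu); rewrite an.
  move=> /andP[ax xn] y yu.
  by apply/implyP => ay; rewrite ax (leq_trans xn) // (next_above_min uk).
have gap : ~~ has (fun y => a < y < next_above u a)%N (rcons u a).
  apply/hasPn => y; rewrite mem_rcons inE => /predU1P[->|yu]; first by rewrite ltnn.
  by apply/negP => /andP[ay]; rewrite ltnNge (next_above_min uk).
rewrite /drops; case: ltnP => h.
  rewrite (@ext_beta t r _ a (next_above u a)) ?mx' ?rkE
    ?size_rcons ?su ?mem_rcons ?inE ?lu ?nu ?orbT //.
  - by case: eqP; rewrite ?mul1r ?mul0r.
  - by rewrite leqW // (leq_trans lk).
  - by rewrite h ltnW.
have nE : next_above u a = last 0%N u by apply/eqP; rewrite eqn_leq nl.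
rewrite nE in okE gap.
rewrite (@ext_sigma t r _ a) ?mx' ?rkE
    ?size_rcons ?su ?mem_rcons ?inE ?lu ?nu ?orbT //.
- by case: eqP; rewrite ?mul1r ?mul0r.
- by rewrite leqW // (leq_trans lk).
Qed.

Lemma ext_weakinc t r k u : u \in weakinc k ->
  ext t r.+1 u = (if (k == last 0%N u + t.+1)%N then omega r u else 0)
    + \sum_(last 0%N u <= x < k.+1) ext t r (rcons u x).
Proof.
move=> uk; have [su so lk] := mem_weakinc uk; rewrite /= su.
under eq_bigl => x do rewrite admits_sorted //.
rewrite (@big_cat_nat _ _ _ (last 0%N u)) //=; last by lia.
congr (_ + _); case: eqP => h; last first.
  by rewrite big_nat big1 // => a al; rewrite (ext_drop t r uk) // (introF eqP h).
rewrite /omega big_nat [RHS]big_nat; apply: eq_bigr => a al.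
by rewrite (ext_drop t r uk) // -h eqxx.
Qed.

(** [ext_weakinc] iterated: a word never drops, or first drops after [k + i] letters, with
    [r - i.+1] letters beyond the drop. *)
Lemma sum_ext t r k : \sum_(u <- weakinc k) ext t r u =
  \sum_(u <- weakinc (k + r)) (has_rank t u)%:R
  + \sum_(0 <= i < r) \sum_(u <- weakinc (k + i) | (k + i == last 0 u + t.+1)%N)
       omega (r - i.+1) u.
Proof.
elim: r k => [|r IH] k; first by rewrite big_geq // addr0 addn0.
transitivity (\sum_(u <- weakinc k | (k == last 0 u + t.+1)%N) omega r u
              + \sum_(u <- weakinc k.+1) ext t r u).
  rewrite sum_weakincS [X in _ = X + _]big_mkcond -big_split big_seq [RHS]big_seq.
  by apply: eq_bigr => u uk; rewrite (ext_weakinc t r uk).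
rewrite IH big_nat_recl // addn0 subn1 addSnnS addrCA; congr (_ + (_ + _)).
by apply: eq_bigr => i _; rewrite addSnnS subSS.
Qed.

(** Without a drop, rank [t] forces the last entry [n - t - 1], and [lowE] counts the rest.
    Otherwise a prefix with last entry [x] has length [x + t + 1], and [n - t - 2 - x] letters
    follow the drop. *)
Lemma ext_nil t n : (t < n)%N -> ext t n [::] =
  ballot (n - t - 1) t.+1
  + (if (t.+1 < n)%N then conv (n - t.+2) (fun x r => Omega r (x + t).+1 x) else 0).
Proof.
move=> tn; have := sum_ext t n 0; rewrite {1}/weakinc big_seq1 => ->; congr (_ + _).
  case: n tn => // n tn; rewrite add0n big_seq.
  under eq_bigr => u uk do rewrite (has_rank_weakinc t uk).
  rewrite -big_seq (_ : (n.+1 - t - 1 = n - t)%N); last by lia.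
  transitivity (\sum_(u <- weakinc n.+1 | last 0%N u == (n - t)%N) (1 : rat)).
    rewrite [RHS]big_mkcond; apply: eq_bigr => u _.
    have -> : (last 0%N u == (n - t)%N) = (n.+1 == last 0 u + t.+1)%N by lia.
    by case: eqP.
  rewrite sum_weakinc_last_eq leq_subr -/(low n (n - t)) lowE ?leq_subr //.
  by congr (ballot _ _); lia.
under eq_bigr => i _ do rewrite add0n.
(* Prefixes shorter than [t.+1] cannot have rank [t]. *)
rewrite (@big_cat_nat _ _ _ t.+1) //= [X in X + _]big_nat.
rewrite [X in X + _]big1 ?add0r; last first.
  by move=> i /andP[_ it]; apply: big1 => u /eqP h; lia.
case: ltnP => h; last by rewrite big_geq.
rewrite -{1}[t.+1]add0n big_addn big_mkord /conv.
rewrite (_ : (n - t.+1 = (n - t.+2).+1)%N); last by lia.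
apply: eq_bigr => i _; rewrite /Omega addnS.
rewrite (_ : (n - (i + t).+2 = n - t.+2 - i)%N); last by lia.
by apply: eq_bigl => u; lia.
Qed.

(** * From words back to finite functions *)

Definition word n (e : {ffun 'I_n -> 'I_n}) : seq nat :=
  [seq (e i : nat) | i <- enum 'I_n].

Lemma size_word n (e : {ffun 'I_n -> 'I_n}) : size (word e) = n.
Proof. by rewrite size_map size_enum_ord. Qed.

Lemma nth_word n (e : {ffun 'I_n -> 'I_n}) (i : 'I_n) : nth 0%N (word e) i = e i.
Proof. by rewrite (nth_map i) ?size_enum_ord ?nth_ord_enum. Qed.

Lemma word_inj n : injective (@word n).
Proof.
move=> e e' h; apply/ffunP => i; apply: val_inj.
by rewrite /= -!nth_word h.
Qed.

Lemma word_exists n (u : seq nat) : size u = n -> all (gtn n) u ->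
  exists e : {ffun 'I_n -> 'I_n}, word e = u.
Proof.
move=> su /allP un; exists [ffun i : 'I_n => insubd i (nth 0%N u i)].
apply: (@eq_from_nth _ 0%N); rewrite size_word ?su // => i ni.
rewrite -[i]/(val (Ordinal ni)) nth_word ffunE val_insubd /=.
have -> // : (nth 0 u i < n)%N by apply: un; rewrite mem_nth // su.
Qed.

Lemma valid_nth w i : valid w -> (i < size w)%N -> (nth 0 w i <= i)%N.
Proof. by move=> /allP/(_ i); rewrite mem_iota => h iw; case/andP: (h iw). Qed.

(** Sorting the sequences by their entry at position [size u] reproduces the recursion of [ext]. *)
Lemma card_ext n t r u : valid u -> (size u + r = n)%N ->
  \sum_(e : {ffun 'I_n -> 'I_n} | [&& valid (word e), has_rank t (word e)
                                   & take (size u) (word e) == u]) 1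
  = ext t r u.
Proof.
elim: r u => [|r IH] u gu sn.
  have un : all (gtn n) u.
    by apply/(all_nthP 0%N) => i iu; have := valid_nth gu iu; rewrite /=; lia.
  have [|e eu] := word_exists _ un; first by lia.
  rewrite /= (eq_bigl (fun e' => (e' == e) && has_rank t u)); last first.
    move=> e'; rewrite (@take_oversize _ (size u)) ?size_word; last by lia.
    rewrite -eu.
    by rewrite (inj_eq (@word_inj n)); case: eqP => [->|_]; rewrite ?andbF // eu gu andbT.
  by case: (has_rank t u); [under eq_bigl do rewrite andbT; rewrite big_pred1_eq
                     | rewrite big1 // => e' /andP[]].
have un : (size u < n)%N by lia.
rewrite (partition_big (fun e : {ffun 'I_n -> 'I_n} => e (Ordinal un)) predT) //=.
transitivity (\sum_(x < n | (x < (size u).+1)%N && admits u x)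
                ext t r (rcons u x)); last first.
  rewrite [RHS]big_mkord (big_ord_widen_cond n (admits u) (fun x => ext t r (rcons u x))) //.
  by apply: eq_bigl => x; rewrite andbC.
rewrite [RHS]big_mkcond; apply: eq_bigr => x _.
have tkE (e : {ffun 'I_n -> 'I_n}) :
    (take (size u) (word e) == u) && (e (Ordinal un) == x) =
    (take (size (rcons u x)) (word e) == rcons u x).
  rewrite size_rcons (take_nth 0%N) ?size_word //.
  by rewrite (nth_word e (Ordinal un)) eqseq_rcons.
rewrite (eq_bigl (fun e : {ffun 'I_n -> 'I_n} => [&& valid (word e), has_rank t (word e) &
   take (size (rcons u x)) (word e) == rcons u x])); last first.
  by move=> e; rewrite -tkE !andbA.
case: ifP => [/andP[xu okx]|h].
  by rewrite IH ?size_rcons ?addSnnS // valid_rcons gu -ltnS xu.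
rewrite big1 // => e /and3P[ge _ /eqP ex]; have := valid_take (size (rcons u x)) ge.
by rewrite ex valid_rcons gu -ltnS h.
Qed.

Lemma order_iso_102 (a b c : nat) :
  order_iso [tuple a; b; c] pat102 = (b < a < c)%N.
Proof.
apply/forallP/idP => [h|/andP[ba ac] i].
  have /forallP/(_ (Ordinal (isT : 1 < 3)%N)) := h ord0.
  have /forallP/(_ (Ordinal (isT : 2 < 3)%N)) := h ord0.
  by rewrite !(tnth_nth 0%N) /=; lia.
apply/forallP => j; rewrite !(tnth_nth 0%N).
by case: i j => [[|[|[|i]]] //= _] [[|[|[|j]]] //= _]; lia.
Qed.

Lemma order_iso_210 (a b c : nat) :
  order_iso [tuple a; b; c] pat210 = (c < b < a)%N.
Proof.
apply/forallP/idP => [h|/andP[cb ba] i].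
  have /forallP/(_ (Ordinal (isT : 1 < 3)%N)) := h ord0.
  have /forallP/(_ (Ordinal (isT : 2 < 3)%N)) := h (Ordinal (isT : 1 < 3)%N).
  by rewrite !(tnth_nth 0%N) /=; lia.
apply/forallP => j; rewrite !(tnth_nth 0%N).
by case: i j => [[|[|[|i]]] //= _] [[|[|[|j]]] //= _]; lia.
Qed.

(** For [i < j < k] with [e j < e i], a 102 means [e k > e i] and a 210 means [e k < e j]; avoiding
    both means [e j <= e k <= e i]. *)
Lemma valid_word n (e : {ffun 'I_n -> 'I_n}) : valid (word e) =
  [&& e \in inversion_seq n, avoids e pat102 & avoids e pat210].
Proof.
apply/allP/and3P => [h|[]].
  have h' (k : 'I_n) : (e k <= k)%N /\ admits (take k (word e)) (e k).
    by have /= := h k; rewrite mem_iota size_word nth_word => /(_ (ltn_ord k))/andP[].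
  have hp (i j k : 'I_n) : (i < j)%N -> (j < k)%N -> (e j < e i)%N ->
      (e j <= e k <= e i)%N.
    move=> ij jk; have [_ /(pairwiseP 0%N)/(_ i j)] := h' k.
    rewrite !inE size_takel ?size_word ?(ltnW (ltn_ord k)) //.
    rewrite (nth_take _ jk) (nth_take _ (ltn_trans ij jk)) !nth_word.
    by move=> /(_ (ltn_trans ij jk) jk ij)/implyP.
  split; first by rewrite inE; apply/forallP => k; case: (h' k).
    apply/existsP => -[i /existsP[j /existsP[k /and3P[ij jk]]]].
    by rewrite order_iso_102 => /andP[ji ik]; have := hp _ _ _ ij jk ji; lia.
  apply/existsP => -[i /existsP[j /existsP[k /and3P[ij jk]]]].
  by rewrite order_iso_210 => /andP[kj ji]; have := hp _ _ _ ij jk ji; lia.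
rewrite inE => /forallP inv /existsP a102 /existsP a210 k.
rewrite mem_iota size_word leq0n add0n => kn; have := inv (Ordinal kn).
rewrite -(nth_word e (Ordinal kn)) /= => -> /=.
apply/(pairwiseP 0%N) => i j; rewrite !inE size_takel ?size_word ?(ltnW kn) //.
move=> ik jk ij; rewrite !nth_take //.
have iN := ltn_trans ik kn; have jN := ltn_trans jk kn.
have nw m (mn : (m < n)%N) : nth 0%N (word e) m = e (Ordinal mn).
  exact: (nth_word e (Ordinal mn)).
rewrite (nw _ iN) (nw _ jN) (nw _ kn); apply/implyP => ji.
apply/negPn/negP => hk; case/orP: (leq_total (e (Ordinal kn)) (e (Ordinal iN))) => hh.
  case: a210; exists (Ordinal iN); apply/existsP; exists (Ordinal jN); apply/existsP.
  by exists (Ordinal kn); rewrite order_iso_210; apply/and3P; split=> //; lia.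
case: a102; exists (Ordinal iN); apply/existsP; exists (Ordinal jN); apply/existsP.
by exists (Ordinal kn); rewrite order_iso_102; apply/and3P; split=> //; lia.
Qed.

Lemma fdes_pathE x w (g := fun p => if (p < (size w).+1)%N
                                 then (nth 0%N (x :: w) p)%:Z else -1) :
  fdes_path x w = (find (fun p => g p.+1 < g p) (iota 0 (size w).+1)).+1.
Proof.
rewrite /g {g}; elim: w x => [|y w IH] x //=.
rewrite ltz_nat; case: ifP => // _; congr _.+1.
rewrite IH /=; case: ifP => //= _.
have -> : iota 2 (size w) = map succn (iota 1 (size w)) by exact: (iotaDl 1 1).
by rewrite find_map.
Qed.

Lemma fdes_word n (e : {ffun 'I_n -> 'I_n}) : (0 < n)%N -> fdes e = fdes_seq (word e).
Proof.
move=> n0; have sw := size_word e; rewrite /fdes.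
have entryE p : entry e p = if (p < n)%N then (nth 0%N (word e) p)%:Z else -1.
  rewrite /entry; case: insubP => [i pn <-|]; first by rewrite ltn_ord nth_word.
  by move=> /negbTE->.
case: (word e) sw entryE => [|x w] sw entryE; first by rewrite -sw in n0.
rewrite [fdes_seq _]/= fdes_pathE -/(size (x :: w)) sw; congr _.+1.
by apply: eq_find => p; rewrite !entryE.
Qed.

Lemma has_rank_word n t (e : {ffun 'I_n -> 'I_n}) : (0 < n)%N ->
  (rank e == t%:Z) = has_rank t (word e).
Proof.
move=> n0; rewrite /rank /has_rank fdes_word // /max_entry /word big_map big_enum /=.
by set a := fdes_seq _; set b := \max_(_ in _) _; lia.
Qed.

Theorem proposition5p15 (n t : nat) (hn : (2 <= n)%N) (ht : (t <= n - 1)%N) :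
  (#|[set e in inversion_seq n |
       [&& avoids e pat102, avoids e pat210 & rank e == t%:Z]]|%:R
   = ballot (n - t - 1)%N t.+1
     + t.+1%:R * (\sum_(0 <= i < n - t - 2) 'C(2 * i + t + 3, i)%:R)
     + \sum_(0 <= i < n - t - 3) (ballot i (t + 6)%N - ballot i 5)
   :> rat)%R.
Proof.
rewrite -sum1_card natr_sum.
transitivity (ext t n [::]); last first.
  rewrite ext_nil; last by lia.
  (* When [t = n - 1] there is no room for a drop, and both sums of the formula are empty. *)
  rewrite -addrA; congr (_ + _); case: ltnP => h; last first.
    by rewrite !big_geq ?mulr0 ?addr0 //; lia.
  rewrite conv_Omega (_ : n - t - 2 = n - t.+2)%N; last by lia.
  by rewrite (_ : n - t - 3 = (n - t.+2).-1)%N //; lia.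
rewrite -(@card_ext n t n [::]) //; apply: eq_bigl => e.
by rewrite inE take0 eqxx andbT valid_word has_rank_word ?(ltnW hn) // !andbA.
Qed.
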